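(* Suppose the standing assumption on $C,h,f,\Psi$ (see context) holds, let $F=f+\Psi$, let $f$ be $L$-smooth relative to $h$ on $C$, and let $\gamma$ be a uniform triangle scaling exponent of $D_h$. The sequences generated by the ABDA method (described in the context) with this $\gamma$ satisfy: (a) If $z_0=\operatorname{arg\,min}_{z\in C}h(z)$, then for any $x\in\operatorname{dom}h$, $$F(x_{k+1})-F(x)\le\left(\frac{\gamma}{k+\gamma}\right)^{\gamma}L\,\big(h(x)-h(z_0)\big),\qquad\forall\,k\ge0;$$ (b) Otherwise, for any $x\in\operatorname{dom}h$, $$F(x_{k+1})-F(x)\le\left(\frac{\gamma}{k+\gamma}\right)^{\gamma}L\,\big(h(x)-h(z_1)+D_h(z_1,z_0)\big),\qquad\forall\,k\ge0.$$
   Context: Problem: minimize $F(x)=f(x)+\Psi(x)$ over $x\in C$, where $f$ is differentiable on an open set containing $\operatorname{rint}C$ ($\operatorname{rint}$ = relative interior). Standing assumption: $C\subset\mathbb{R}^n$ is a closed convex set and $h:\mathbb{R}^n\to(-\infty,+\infty]$ is strictly convex and differentiable on an open set containing $\operatorname{rint}C$. Moreover: (1) $h$ is of Legendre type, i.e. essentially smooth and strictly convex in $\operatorname{rint}\operatorname{dom}h$, where essentially smooth means that it is differentiable and $\|\nabla h(x_k)\|\to\infty$ for every sequence $\{x_k\}$ converging to a boundary point of $\operatorname{dom}h$; (2) $f:\mathbb{R}^n\to(-\infty,\infty]$ is proper, closed and convex, and differentiable on $\operatorname{rint}C$; (3) $\Psi:\mathbb{R}^n\to(-\infty,\infty]$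 is proper, closed and convex, with $\operatorname{dom}\Psi\cap\operatorname{rint}\operatorname{dom}h\ne\emptyset$; (4) $\inf_{x\in C}\{f(x)+\Psi(x)\}>-\infty$; (5) the Bregman proximal gradient (BPG) step $x_{k+1}=\operatorname{arg\,min}_{x\in C}\{f(x_k)+\langle\nabla f(x_k),x-x_k\rangle+L_kD_h(x,x_k)+\Psi(x)\}$ (with $L_k>0$) is well posed, meaning that $x_{k+1}$ is unique and belongs to $\operatorname{rint}\operatorname{dom}h$. Bregman distance: $D_h(x,y)=h(x)-h(y)-\langle\nabla h(y),x-y\rangle$ for $x\in\operatorname{dom}h$, $y\in\operatorname{rint}\operatorname{dom}h$. Relative smoothness: $f$ is $L$-smooth relative to $h$ on $C$ if $L>0$ and $f(x)\le f(y)+\langle\nabla f(y),x-y\rangle+L\,D_h(x,y)$ for all $x\in C$, $y\in\operatorname{rint}C$. Uniform triangle scaling exponent (TSE): $\gamma>0$ is a uniform TSE of $D_h$ if for all $x,z,\tilde z\in\operatorname{rint}\operatorname{dom}h$ and all $\theta\in[0,1]$, $D_h((1-\theta)x+\theta z,(1-\theta)x+\theta\tilde z)\le\theta^\gamma D_h(z,\tilde z)$. Linearization: $\ell(x|y)=f(y)+\langle\nabla f(y),x-y\rangle+\Psi(x)$. ABDA method (accelerated Bregman dual averaging): input $z_0\in\operatorname{rint}C$ and $\gamma>1$; set $x_0=z_0$, $\psi_0\equiv0$, $\theta_0=1$. For $k=0,1,2,\dots$: $y_k=(1-\theta_k)x_k+\theta_kz_k$; $\psi_{k+1}(x)=\psi_k(x)+\theta_k^{1-\gamma}\ell(x|y_k)$;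 $z_{k+1}=\operatorname{arg\,min}_{z\in C}\{\psi_{k+1}(z)+L\,h(z)\}$; $x_{k+1}=(1-\theta_k)x_k+\theta_kz_{k+1}$; find $\theta_{k+1}\in(0,1]$ such that $\frac{1-\theta_{k+1}}{\theta_{k+1}^\gamma}=\frac1{\theta_k^\gamma}$.
   Formalization: The bounds are stated for x in C ∩ dom h rather than all x in dom h (false for x outside C, e.g. C=[0,∞), h=x²/2, f(x)=x, Ψ=0, x=-1), and f is assumed differentiable at each y_k so that the method's gradients exist. *)

(* Defs.v *)
From mathcomp Require Import all_boot all_order all_algebra.
From mathcomp Require Import all_classical all_reals all_analysis.

Set Implicit Arguments.
Unset Strict Implicit.
Unset Printing Implicit Defensive.

Import Order.TTheory GRing.Theory Num.Theory.
Import numFieldNormedType.Exports.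

Local Open Scope classical_set_scope.
Local Open Scope ring_scope.

(* R^n is 'rV[R]_n.  The library norm `|v| on it is the sup norm; it is only
   used here through its topology.  The Euclidean structure is dotp, enorm. *)
Definition dotp (R : realType) (n : nat) (u v : 'rV[R]_n) : R :=
  \sum_(i < n) u ord0 i * v ord0 i.

Definition enorm (R : realType) (n : nat) (u : 'rV[R]_n) : R :=
  Num.sqrt (dotp u u).

Definition affine_set (R : realType) (n : nat) (M : set 'rV[R]_n) : Prop :=
  forall (x y : 'rV[R]_n) (t : R), M x -> M y -> M ((1 - t) *: x + t *: y).

Definition affine_hull (R : realType) (n : nat) (A : set 'rV[R]_n) :
    set 'rV[R]_n :=
  smallest (@affine_set R n) A.

Definition rint (R : realType) (n : nat) (A : set 'rV[R]_n) : set 'rV[R]_n :=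
  [set x | A x /\ exists2 U, nbhs x U & U `&` affine_hull A `<=` A].

Definition dom (R : realType) (n : nat) (f : 'rV[R]_n -> \bar R) :
    set 'rV[R]_n :=
  [set x | (f x < +oo)%E].

Definition proper (R : realType) (n : nat) (f : 'rV[R]_n -> \bar R) : Prop :=
  (forall x, -oo < f x)%E /\ dom f !=set0.

Definition convex_ext (R : realType) (n : nat) (f : 'rV[R]_n -> \bar R) :
    Prop :=
  forall (x y : 'rV[R]_n) (t : R), 0 < t < 1 ->
    (f (t *: x + (1 - t) *: y)%R <= t%:E * f x + (1 - t)%:E * f y)%E.

Definition strictly_convex_on (R : realType) (n : nat) (A : set 'rV[R]_n)
    (f : 'rV[R]_n -> \bar R) : Prop :=
  forall (x y : 'rV[R]_n) (t : R), A x -> A y -> x <> y -> 0 < t < 1 ->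
    (f (t *: x + (1 - t) *: y)%R < t%:E * f x + (1 - t)%:E * f y)%E.

(* Frechet differentiability of an extended-valued function; it entails that
   f is finite on a full neighbourhood of x. *)
Definition differentiable_ext (R : realType) (n : nat)
    (f : 'rV[R]_n -> \bar R) (x : 'rV[R]_n) : Prop :=
  (\forall y \near x, f y \is a fin_num) /\
  differentiable (fun y => fine (f y)) x.

(* Meaningful only at points where differentiable_ext f holds. *)
Definition grad (R : realType) (n : nat) (f : 'rV[R]_n -> \bar R)
    (x : 'rV[R]_n) : 'rV[R]_n :=
  \row_(i < n) 'D_(delta_mx ord0 i) (fun y => fine (f y)) x.

Definition differentiable_around (R : realType) (n : nat)
    (f : 'rV[R]_n -> \bar R) (A : set 'rV[R]_n) : Prop :=
  exists U : set 'rV[R]_n,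
    [/\ open U, A `<=` U & forall x, U x -> differentiable_ext f x].

Definition is_argmin (R : realType) (n : nat) (C : set 'rV[R]_n)
    (g : 'rV[R]_n -> \bar R) (z : 'rV[R]_n) : Prop :=
  C z /\ forall w, C w -> (g z <= g w)%E.

Definition is_unique_argmin (R : realType) (n : nat) (C : set 'rV[R]_n)
    (g : 'rV[R]_n -> \bar R) (z : 'rV[R]_n) : Prop :=
  is_argmin C g z /\ forall w, is_argmin C g w -> w = z.

(* Equals +oo when h x = +oo. *)
Definition bregman (R : realType) (n : nat) (h : 'rV[R]_n -> \bar R)
    (x y : 'rV[R]_n) : \bar R :=
  (h x - h y - (dotp (grad h y) (x - y)%R)%:E)%E.

(* The sequence u stays in rint (dom h), where the gradient is defined. *)
Definition essentially_smooth (R : realType) (n : nat)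
    (h : 'rV[R]_n -> \bar R) : Prop :=
  (forall x, rint (dom h) x -> differentiable_ext h x) /\
  (forall (u : nat -> 'rV[R]_n) (x : 'rV[R]_n),
     (forall k, rint (dom h) (u k)) ->
     (closure (dom h) `\` interior (dom h)) x ->
     u k @[k --> \oo] --> x ->
     enorm (grad h (u k)) @[k --> \oo] --> +oo).

Definition Legendre (R : realType) (n : nat) (h : 'rV[R]_n -> \bar R) : Prop :=
  essentially_smooth h /\ strictly_convex_on (rint (dom h)) h.

Definition linearization (R : realType) (n : nat)
    (f Psi : 'rV[R]_n -> \bar R) (x y : 'rV[R]_n) : \bar R :=
  (f y + (dotp (grad f y) (x - y)%R)%:E + Psi x)%E.

Definition BPG_objective (R : realType) (n : nat)
    (h f Psi : 'rV[R]_n -> \bar R) (Lk : R) (xk x : 'rV[R]_n) : \bar R :=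
  (f xk + (dotp (grad f xk) (x - xk)%R)%:E + Lk%:E * bregman h x xk + Psi x)%E.

Record standing_assumption (R : realType) (n : nat) (C : set 'rV[R]_n)
    (h f Psi : 'rV[R]_n -> \bar R) : Prop := StandingAssumption {
  sa_C_closed : closed C;
  sa_C_convex : convex_set C;
  sa_h_gtNy : forall x, (-oo < h x)%E;
  sa_h_strictly_convex : strictly_convex_on (dom h) h;
  sa_h_differentiable : differentiable_around h (rint C);
  sa_h_Legendre : Legendre h;
  sa_f_proper : proper f;
  sa_f_closed : lower_semicontinuous f;
  sa_f_convex : convex_ext f;
  sa_f_differentiable : differentiable_around f (rint C);
  sa_Psi_proper : proper Psi;
  sa_Psi_closed : lower_semicontinuous Psi;
  sa_Psi_convex : convex_ext Psi;
  sa_dom_Psi : dom Psi `&` rint (dom h) !=set0;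
  sa_bounded_below : (-oo < ereal_inf [set f x + Psi x | x in C])%E;
  sa_BPG_well_posed : forall (xk : 'rV[R]_n) (Lk : R), rint C xk -> 0 < Lk ->
    exists2 z, is_unique_argmin C (BPG_objective h f Psi Lk xk) z
             & rint (dom h) z }.

Definition relatively_smooth (R : realType) (n : nat) (C : set 'rV[R]_n)
    (h f : 'rV[R]_n -> \bar R) (L : R) : Prop :=
  0 < L /\
  forall x y, C x -> rint C y ->
    (f x <= f y + (dotp (grad f y) (x - y)%R)%:E + L%:E * bregman h x y)%E.

Definition uniform_TSE (R : realType) (n : nat) (h : 'rV[R]_n -> \bar R)
    (gamma : R) : Prop :=
  0 < gamma /\
  forall (x z z' : 'rV[R]_n) (theta : R),
    rint (dom h) x -> rint (dom h) z -> rint (dom h) z' -> 0 <= theta <= 1 ->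
    (bregman h ((1 - theta) *: x + theta *: z)%R
               ((1 - theta) *: x + theta *: z')%R
       <= (theta `^ gamma)%:E * bregman h z z')%E.

(* abda_grad says that the gradient of f at y_k used by the method exists; it
   is automatic as long as y_k lies in rint C. *)
Record ABDA (R : realType) (n : nat) (C : set 'rV[R]_n)
    (h f Psi : 'rV[R]_n -> \bar R) (L gamma : R)
    (x y z : nat -> 'rV[R]_n) (psi : nat -> 'rV[R]_n -> \bar R)
    (theta : nat -> R) : Prop := ABDARun {
  abda_gamma : 1 < gamma;
  abda_z0 : rint C (z 0%N);
  abda_x0 : x 0%N = z 0%N;
  abda_psi0 : psi 0%N = (fun=> 0%E);
  abda_theta0 : theta 0%N = 1;
  abda_y : forall k, y k = (1 - theta k) *: x k + theta k *: z k;
  abda_grad : forall k, differentiable_ext f (y k);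
  abda_psi : forall k w, psi k.+1 w =
    (psi k w + (theta k `^ (1 - gamma))%:E * linearization f Psi w (y k))%E;
  abda_z : forall k,
    is_argmin C (fun w => psi k.+1 w + L%:E * h w)%E (z k.+1);
  abda_x : forall k, x k.+1 = (1 - theta k) *: x k + theta k *: z k.+1;
  abda_theta : forall k, 0 < theta k.+1 <= 1 /\
    (1 - theta k.+1) / theta k.+1 `^ gamma = 1 / theta k `^ gamma }.

(* Main.v *)
Require Import Defs.
From mathcomp Require Import all_boot all_order all_algebra.
From mathcomp Require Import all_classical all_reals all_analysis.
From mathcomp Require Import ring lra.

Set Implicit Arguments.
Unset Strict Implicit.
Unset Printing Implicit Defensive.

Import Order.TTheory GRing.Theory Num.Theory.
Import numFieldNormedType.Exports.

Local Open Scope classical_set_scope.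
Local Open Scope ring_scope.

(** The proof is an estimate-sequence argument.  Write a_k = theta_k^(-gamma),
    D_k = D_h(z_{k+1}, z_k), and for k >= 1 let m_k = psi_k(z_k) + L h(z_k) be
    the minimum of psi_k + L h over C.

    Relative smoothness at y_k and the triangle scaling property give the
    one-step descent (abda_descent)
      F(x_{k+1}) <= (1 - theta_k) F(x_k) + theta_k l(z_{k+1} | y_k)
                    + L theta_k^gamma D_k.
    Multiply by a_k.  The rule for theta turns a_k (1 - theta_k) into a_{k-1},
    and the three-point inequality for the minimizer z_k (argmin_first_order)
    bounds a_k theta_k l(z_{k+1} | y_k) + L D_k by m_{k+1} - m_k.  Telescoping
    from k = 1 yields
      a_k F(x_{k+1}) - m_{k+1} <= F(x_1) - m_1 <= L (D_0 - h(z_1)).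
    Convexity of f bounds m_{k+1} by a_k F(u) + L h(u), hence
      F(x_{k+1}) - F(u) <= theta_k^gamma L E,  E = h(u) - h(z_1) + D_0,
    and theta_k <= gamma / (k + gamma) by Bernoulli's inequality (theta_rate).
    This is the estimate of the second part when E >= 0.

    When E < 0, replacing theta_k^gamma by the larger rate goes the wrong way.
    Testing the minimum m_{k+1} at z_1 = x_1 instead shows
    F(x_{k+1}) <= F(x_1) <= F(u) + L E, which is enough because the rate is at
    most 1.  The first part follows from the second estimate: if z_0 minimizes
    h over C then D_0 <= h(z_1) - h(z_0).

    Two points are geometric.  The three-point inequality and triangle scaling
    need z_k in the relative interior of dom h, which essential smoothness
    forces on minimizers (argmin_rint).  And y_k may lie on the relative
    boundary of C, so relative smoothness is first extended to such points at
    which f and h are differentiable (relatively_smooth_closed). *)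

(** * The inner product *)

Lemma dotpDr (R : realType) (n : nat) (u v w : 'rV[R]_n) :
  dotp u (v + w) = dotp u v + dotp u w.
Proof.
by rewrite /dotp -big_split/=; apply: eq_bigr => i _; rewrite mxE mulrDr.
Qed.

Lemma dotpZr (R : realType) (n : nat) (a : R) (u v : 'rV[R]_n) :
  dotp u (a *: v) = a * dotp u v.
Proof.
by rewrite /dotp mulr_sumr; apply: eq_bigr => i _; rewrite mxE mulrCA.
Qed.

Lemma dotpNr (R : realType) (n : nat) (u v : 'rV[R]_n) :
  dotp u (- v) = - dotp u v.
Proof. by rewrite -scaleN1r dotpZr mulN1r. Qed.

Lemma dotpBr (R : realType) (n : nat) (u v w : 'rV[R]_n) :
  dotp u (v - w) = dotp u v - dotp u w.
Proof. by rewrite dotpDr dotpNr. Qed.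

Lemma dotp_delta (R : realType) (n : nat) (u : 'rV[R]_n) (i : 'I_n) :
  dotp u (delta_mx ord0 i) = u ord0 i.
Proof.
rewrite /dotp (bigD1 i)//= mxE !eqxx mulr1 big1 ?addr0// => j ji.
by rewrite mxE (negbTE ji) andbF mulr0.
Qed.

(** * Convex extended-valued functions *)

Lemma finite_EFin (R : realType) (v : \bar R) :
  (-oo < v)%E -> (v < +oo)%E -> v = (fine v)%:E.
Proof. by case: v. Qed.

Lemma le_EFin_fin (R : realType) (v : \bar R) (r : R) :
  (-oo < v)%E -> (v <= r%:E)%E -> v = (fine v)%:E /\ fine v <= r.
Proof. by case: v. Qed.

(** Convexity of the epigraph, for a function that avoids -oo.  Comparing f
    with real bounds r and s, rather than combining its values, keeps
    indeterminate forms out of the later computations. *)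
Definition cvx (R : realType) (n : nat) (f : 'rV[R]_n -> \bar R) : Prop :=
  (forall x, -oo < f x)%E /\
  forall (x y : 'rV[R]_n) (r s t : R), 0 <= t <= 1 ->
    (f x <= r%:E)%E -> (f y <= s%:E)%E ->
    (f ((1 - t) *: x + t *: y)%R <= ((1 - t) * r + t * s)%:E)%E.

Lemma combine0 (R : realType) (n : nat) (x y : 'rV[R]_n) :
  (1 - 0) *: x + 0 *: y = x.
Proof. by rewrite subr0 scale1r scale0r addr0. Qed.

Lemma combine1 (R : realType) (n : nat) (x y : 'rV[R]_n) :
  (1 - 1) *: x + 1 *: y = y.
Proof. by rewrite subrr scale1r scale0r add0r. Qed.

Lemma combineE (R : realType) (n : nat) (x y : 'rV[R]_n) (t : R) :
  (1 - t) *: x + t *: y = x + t *: (y - x).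
Proof. by rewrite scalerBl scale1r scalerBr addrA addrAC. Qed.

Lemma open_segment_cvx (R : realType) (n : nat) (f : 'rV[R]_n -> \bar R) :
  (forall x, -oo < f x)%E ->
  (forall (x y : 'rV[R]_n) (t : R), 0 < t < 1 -> dom f x -> dom f y ->
    (f ((1 - t) *: x + t *: y)%R <= (1 - t)%:E * f x + t%:E * f y)%E) ->
  cvx f.
Proof.
move=> fNy fc; split => // x y r s t /andP[t0 t1] fx fy.
have [->|tn0] := eqVneq t 0; first by rewrite combine0 subr0 mul1r mul0r addr0.
have [->|tn1] := eqVneq t 1; first by rewrite combine1 subrr mul1r mul0r add0r.
have t01 : 0 < t < 1 by rewrite !lt_neqAle eq_sym tn0 tn1 t0.
have [fxE fxr] := le_EFin_fin (fNy x) fx.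
have [fyE fys] := le_EFin_fin (fNy y) fy.
have := fc x y t t01; rewrite /dom/= fxE fyE !ltry.
move=> /(_ isT isT)/le_trans; apply.
by rewrite lee_fin lerD// ler_wpM2l// subr_ge0.
Qed.

Lemma convex_ext_cvx (R : realType) (n : nat) (f : 'rV[R]_n -> \bar R) :
  (forall x, -oo < f x)%E -> convex_ext f -> cvx f.
Proof.
move=> fNy fc; apply: open_segment_cvx => // x y t t01 _ _.
have /(_ _)/le_trans := fc x y (1 - t); rewrite subKr; apply => //.
by move: t01 => /andP[? ?]; apply/andP; split; lra.
Qed.

Lemma strictly_convex_cvx (R : realType) (n : nat) (f : 'rV[R]_n -> \bar R) :
  (forall x, -oo < f x)%E -> strictly_convex_on (dom f) f -> cvx f.
Proof.
move=> fNy fc; apply: open_segment_cvx => // x y t t01 fx fy.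
have [<-|/eqP xy] := eqVneq x y.
  rewrite -scalerDl subrK scale1r (finite_EFin (fNy x) fx) -!EFinM -EFinD.
  by rewrite -mulrDl subrK mul1r.
have := fc x y (1 - t) fx fy xy; rewrite subKr => H.
by apply/ltW/H; move: t01 => /andP[? ?]; apply/andP; split; lra.
Qed.

Lemma cvxD (R : realType) (n : nat) (f g : 'rV[R]_n -> \bar R) :
  cvx f -> cvx g -> cvx (fun x => (f x + g x)%E).
Proof.
move=> [fNy fc] [gNy gc]; split => [x|x y r s t t01 fgx fgy].
  move: (fNy x) (gNy x).
  by case: (f x) => [a||]; case: (g x) => [b||]//= _ _; rewrite -EFinD ltNyr.
have fin v : forall q : R, (f v + g v <= q%:E)%E ->
    [/\ (f v <= (fine (f v))%:E)%E, (g v <= (fine (g v))%:E)%E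
      & fine (f v) + fine (g v) <= q].
  by move=> q; move: (fNy v) (gNy v); case: (f v); case: (g v).
have [fx gx xr] := fin _ _ fgx; have [fy gy ys] := fin _ _ fgy.
apply: (le_trans (leeD (fc _ _ _ _ _ t01 fx fy) (gc _ _ _ _ _ t01 gx gy))).
rewrite -EFinD lee_fin.
by move: t01 => /andP[? ?]; nra.
Qed.

Lemma cvxZ (R : realType) (n : nat) (f : 'rV[R]_n -> \bar R) (a : R) :
  0 < a -> cvx f -> cvx (fun x => (a%:E * f x)%E).
Proof.
move=> a0 [fNy fc]; split => [x|x y r s t t01].
  by move: (fNy x); case: (f x) => //= [r|] _; rewrite ?ltNyr// gt0_muley.
have E v (q : R) : (a%:E * v <= q%:E)%E = (v <= (q / a)%:E)%E.
  by rewrite EFinM lee_pdivlMr// muleC.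
rewrite !E => fx fy; apply: (le_trans (fc _ _ _ _ _ t01 fx fy)).
by rewrite lee_fin [leRHS]mulrDl !mulrA.
Qed.

Lemma cvx_affine (R : realType) (n : nat) (c : R) (g y : 'rV[R]_n) :
  cvx (fun x => (c%:E + (dotp g (x - y))%:E)%E).
Proof.
split => [x|x1 x2 r s t t01]; first by rewrite -EFinD ltNyr.
rewrite -!EFinD !lee_fin !dotpBr dotpDr !dotpZr => *.
by move: t01 => /andP[? ?]; nra.
Qed.

Lemma cvx_cst0 (R : realType) (n : nat) : cvx (fun _ : 'rV[R]_n => 0%E).
Proof.
split => [x|x1 x2 r s t t01]; first by rewrite ltNyr.
by rewrite !lee_fin => *; move: t01 => /andP[? ?]; nra.
Qed.

(** * Relative interiors and segments *)

Lemma convex_setP (R : realType) (n : nat) (A : set 'rV[R]_n) :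
  convex_set A ->
  forall x y t, 0 <= t <= 1 -> A x -> A y -> A ((1 - t) *: x + t *: y).
Proof.
move=> Ac x y t /andP[t0 t1] Ax Ay.
have := Ac y x (Itv01 t0 t1); rewrite !inE => /(_ Ay Ax).
by rewrite addrC.
Qed.


Lemma cvx_dom (R : realType) (n : nat) (f : 'rV[R]_n -> \bar R) :
  cvx f -> convex_set (dom f).
Proof.
move=> [fNy fc] x y t; rewrite !inE /dom/= => fx fy.
have t01 : 0 <= (t%:num : R) <= 1 by rewrite ge0 le1.
change (f (t%:num *: x + (1 - t%:num) *: y)%R < +oo)%E; rewrite addrC.
have fyE := finite_EFin (fNy y) fy; have fxE := finite_EFin (fNy x) fx.
have := fc y x (fine (f y)) (fine (f x)) _ t01; rewrite -fyE -fxE.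
by move=> /(_ (lexx _) (lexx _))/le_lt_trans; apply; rewrite ltry.
Qed.

(** The homothety of centre x and ratio 1/s sends (1 - s) x + s w to w and
    preserves the affine hull of A, so a relative neighbourhood of w in A pulls
    back to one of the combination. *)
Lemma rint_segment (R : realType) (n : nat) (A : set 'rV[R]_n)
    (x w : 'rV[R]_n) (s : R) :
  convex_set A -> A x -> rint A w -> 0 < s <= 1 ->
  rint A ((1 - s) *: x + s *: w).
Proof.
move=> /convex_setP Ac Ax [Aw [U Uw UA]] /andP[s0 s1].
have s01 : 0 <= s <= 1 by rewrite ltW.
have sn0 : s != 0 by rewrite gt_eqF.
split; first exact: Ac.
pose g (v : 'rV[R]_n) := s^-1 *: (v - (1 - s) *: x).
have gE v : (1 - s) *: x + s *: g v = v.
  by rewrite /g scalerA divff// scale1r addrC subrK.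
have gw : g ((1 - s) *: x + s *: w) = w.
  by rewrite /g addrAC subrr add0r scalerA mulVf// scale1r.
exists (g @^-1` U).
  have gc : continuous g.
    by move=> v; exact: (cvgZl_tmp (cvgB cvg_id (cvg_cst _))).
  by apply: gc; rewrite gw.
move=> v [/= Ugv Av]; rewrite -(gE v); apply: Ac => //; apply: UA; split => //.
have -> : g v = (1 - s^-1) *: x + s^-1 *: v.
  rewrite /g scalerBr scalerA addrC -scaleNr; congr (_ *: _ + _).
  by rewrite mulrBr mulr1 mulVf// opprB.
move=> B [Baff AB]; apply: (Baff); first exact: AB.
exact: (Av B (conj Baff AB)).
Qed.

Lemma rint_combine (R : realType) (n : nat) (A : set 'rV[R]_n)
    (x w : 'rV[R]_n) (s : R) :
  convex_set A -> rint A x -> rint A w -> 0 <= s <= 1 ->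
  rint A ((1 - s) *: x + s *: w).
Proof.
move=> Ac rx rw /andP[]; rewrite le_eqVlt => /orP[/eqP <- _|s0 s1].
  by rewrite combine0.
by apply: rint_segment => //; [exact: rx.1|rewrite s0].
Qed.

Lemma nbhs_rint (R : realType) (n : nat) (A : set 'rV[R]_n) (x : 'rV[R]_n) :
  nbhs x A -> rint A x.
Proof.
move=> Ax; split; first exact: nbhs_singleton.
by exists A => // v [].
Qed.

(** * One-sided derivatives along segments *)

Lemma differentiable_ext_nbhs_dom (R : realType) (n : nat)
    (f : 'rV[R]_n -> \bar R) (x : 'rV[R]_n) :
  differentiable_ext f x -> nbhs x (dom f).
Proof.
move=> [fx _]; apply: filterS fx => v; rewrite /dom/=.
by case: (f v) => [r||]//; rewrite ltry.
Qed.

Lemma differentiable_ext_fin (R : realType) (n : nat)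
    (f : 'rV[R]_n -> \bar R) (x : 'rV[R]_n) :
  differentiable_ext f x -> f x = (fine (f x))%:E.
Proof. by move=> [/nbhs_singleton fx _]; rewrite fineK. Qed.

Lemma secant_cvg (R : realType) (n : nat) (f : 'rV[R]_n -> \bar R)
    (y d : 'rV[R]_n) :
  differentiable_ext f y ->
  t^-1 * (fine (f (y + t *: d)) - fine (f y)) @[t --> 0^'+]
    --> dotp (grad f y) d.
Proof.
move=> [_ df].
have -> : dotp (grad f y) d = 'D_d (fun v => fine (f v)) y.
  rewrite deriveE// {2}[d]row_sum_delta linear_sum; apply: eq_bigr => i _.
  by rewrite linearZ/= mxE deriveE// mulrC.
apply: cvg_dnbhs_at_right.
rewrite (_ : (fun t : R => _) = fun t => t^-1 *:
  (((fun v => fine (f v)) \o shift y) (t *: d) - fine (f y))).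
  exact: (diff_derivable df).
by apply/funext => t /=; rewrite [y + _]addrC.
Qed.

(** Passing to the limit in a weighted bound on the secants of two functions.
    One function suffices for tangent inequalities and optimality conditions;
    the pair serves the difference L h - f, which appears in relative
    smoothness. *)
Lemma directional_le (R : realType) (n : nat) (f g : 'rV[R]_n -> \bar R)
    (a b c : R) (y d : 'rV[R]_n) :
  differentiable_ext f y -> differentiable_ext g y ->
  (forall t, 0 < t < 1 ->
    a * (fine (f (y + t *: d)) - fine (f y)) +
    b * (fine (g (y + t *: d)) - fine (g y)) <= t * c) ->
  a * dotp (grad f y) d + b * dotp (grad g y) d <= c.
Proof.
move=> dirf dirg H.
apply: (cvgr_to_le (cvgD (cvgMl_tmp (a := a) (secant_cvg (d := d) dirf))
                         (cvgMl_tmp (a := b) (secant_cvg (d := d) dirg)))).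
near=> t.
have t0 : 0 < t by near: t; exact: nbhs_right_gt.
have t1 : t < 1 by near: t; exact: nbhs_right_lt.
have := H t; rewrite t0 t1 => /(_ isT).
rewrite -ler_pdivrMl//; apply: le_trans.
by rewrite mulrDr !(mulrCA t^-1).
Unshelve. all: by end_near. Qed.

Lemma cvx_tangent (R : realType) (n : nat) (f : 'rV[R]_n -> \bar R)
    (x y : 'rV[R]_n) (r : R) :
  cvx f -> differentiable_ext f y -> (f x <= r%:E)%E ->
  fine (f y) + dotp (grad f y) (x - y) <= r.
Proof.
move=> [fNy fc] df fx; have fyE := differentiable_ext_fin df.
suff : 1 * dotp (grad f y) (x - y) + 0 * dotp (grad f y) (x - y)
    <= r - fine (f y) by lra.
apply: directional_le => // t /andP[t0 t1]; rewrite -combineE.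
have t01 : 0 <= t <= 1 by rewrite !ltW.
have := fc y x (fine (f y)) r t t01; rewrite -fyE => /(_ (lexx _) fx) fv.
by have [_ ?] := le_EFin_fin (fNy _) fv; lra.
Qed.

(** * Minimizers of a convex function plus a Legendre function *)

Lemma argmin_finite (R : realType) (n : nat) (C : set 'rV[R]_n)
    (phi h : 'rV[R]_n -> \bar R) (L : R) (z w : 'rV[R]_n) :
  0 < L -> (forall x, -oo < phi x)%E -> (forall x, -oo < h x)%E ->
  is_argmin C (fun x => phi x + L%:E * h x)%E z ->
  C w -> dom phi w -> dom h w -> dom phi z /\ dom h z.
Proof.
move=> L0 phiNy hNy [_ zmin] Cw; rewrite /dom/= => phiw hw.
have := zmin w Cw.
rewrite (finite_EFin (phiNy w) phiw) (finite_EFin (hNy w) hw).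
move: (phiNy z) (hNy z); rewrite -EFinM -EFinD.
by case: (phi z) => [a||]//; case: (h z) => [b||]//=;
  rewrite ?ltry ?gt0_muley ?lte_fin// ?addey ?addye// -?EFinM ?addye// ?leye_eq.
Qed.

Lemma argmin_le (R : realType) (n : nat) (C : set 'rV[R]_n)
    (phi h : 'rV[R]_n -> \bar R) (L : R) (z w : 'rV[R]_n) :
  0 < L -> (forall x, -oo < phi x)%E -> (forall x, -oo < h x)%E ->
  is_argmin C (fun x => phi x + L%:E * h x)%E z ->
  C w -> dom phi w -> dom h w ->
  fine (phi z) + L * fine (h z) <= fine (phi w) + L * fine (h w).
Proof.
move=> L0 phiNy hNy zmin Cw phiw hw.
have [phiz hz] := argmin_finite L0 phiNy hNy zmin Cw phiw hw.
have := zmin.2 w Cw.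
rewrite (finite_EFin (phiNy w) phiw) (finite_EFin (hNy w) hw).
by rewrite (finite_EFin (phiNy z) phiz) (finite_EFin (hNy z) hz) lee_fin.
Qed.

Lemma cvx_fine (R : realType) (n : nat) (f : 'rV[R]_n -> \bar R)
    (x y : 'rV[R]_n) (t : R) :
  cvx f -> dom f x -> dom f y -> 0 <= t <= 1 ->
  dom f ((1 - t) *: x + t *: y) /\
  fine (f ((1 - t) *: x + t *: y)) <= (1 - t) * fine (f x) + t * fine (f y).
Proof.
move=> [fNy fc] fx fy t01.
have := fc x y (fine (f x)) (fine (f y)) t t01.
rewrite -(finite_EFin (fNy x) fx) -(finite_EFin (fNy y) fy).
move=> /(_ (lexx _) (lexx _)) fv.
by have [fvE ?] := le_EFin_fin (fNy _) fv; split => //; rewrite /dom/= fvE ltry.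
Qed.

(** The three-point inequality: phi + L h exceeds its minimum over C at u by at
    least L D_h(u, z).  It is written with the h-terms cancelled. *)
Lemma argmin_first_order (R : realType) (n : nat) (C : set 'rV[R]_n)
    (phi h : 'rV[R]_n -> \bar R) (L : R) (z u : 'rV[R]_n) :
  convex_set C -> 0 < L -> cvx phi -> cvx h ->
  is_argmin C (fun x => phi x + L%:E * h x)%E z -> differentiable_ext h z ->
  C u -> dom phi u -> dom h u ->
  fine (phi z) <= fine (phi u) + L * dotp (grad h z) (u - z).
Proof.
move=> /convex_setP Cc L0 phic hc zmin dh Cu phiu hu.
have [phiz hz] := argmin_finite L0 phic.1 hc.1 zmin Cu phiu hu.
suff : - L * dotp (grad h z) (u - z) + 0 * dotp (grad h z) (u - z)
    <= fine (phi u) - fine (phi z) by lra.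
apply: directional_le => // t /andP[t0 t1]; rewrite -combineE.
have t01 : 0 <= t <= 1 by rewrite !ltW.
have [phiv phile] := cvx_fine phic phiz phiu t01.
have [hv _] := cvx_fine hc hz hu t01.
have Cv := Cc z u t t01 zmin.1 Cu.
by have := argmin_le L0 phic.1 hc.1 zmin Cv phiv hv; lra.
Qed.

Lemma nbhs_direction (R : realType) (n : nat) (A : set 'rV[R]_n)
    (w d : 'rV[R]_n) : nbhs w A -> exists2 r : R, 0 < r & A (w + r *: d).
Proof.
move=> Aw.
have cw : w + r *: d @[r --> (0 : R)^'+] --> w.
  have E0 : w + 0 *: d = w by rewrite scale0r addr0.
  rewrite -[X in _ --> X]E0.
  apply: cvgD; first exact: cvg_cst.
  by apply: cvgZr_tmp; apply: cvg_at_right_filter; exact: cvg_id.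
have : \forall r \near (0 : R)^'+, 0 < r /\ A (w + r *: d).
  by near=> r; split; near: r; [exact: nbhs_right_gt|exact: cw].
by move=> /filter_ex[r [r0 Ar]]; exists r.
Unshelve. all: by end_near. Qed.

(** Move from z to the interior point w of dom h along v_k.  Minimality of z and
    convexity of phi bound the slopes of h at v_k in the direction w - z from
    below.  The tangent of h at v_k, evaluated at points w + r e of dom h, then
    bounds the derivative of h at v_k in every direction e.  If z were on the
    boundary, bounded gradients along v_k --> z would contradict essential
    smoothness. *)
Lemma argmin_rint (R : realType) (n : nat) (C : set 'rV[R]_n)
    (phi h : 'rV[R]_n -> \bar R) (L : R) (z w : 'rV[R]_n) :
  convex_set C -> 0 < L -> cvx phi -> cvx h -> essentially_smooth h ->
  is_argmin C (fun x => phi x + L%:E * h x)%E z ->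
  C w -> dom phi w -> rint (dom h) w -> rint (dom h) z.
Proof.
move=> /convex_setP Cc L0 phic hc [hdiff hblow] zmin Cw phiw rw.
have hw : dom h w := rw.1.
have [phiz hz] := argmin_finite L0 phic.1 hc.1 zmin Cw phiw hw.
apply: contrapT => nrz.
pose v (k : nat) := (1 - harmonic k) *: z + harmonic k *: w : 'rV[R]_n.
have s01 k : 0 < (harmonic k : R) <= 1.
  by rewrite harmonic_gt0/= /harmonic/= invf_le1// ler1n.
have s01' k : 0 <= (harmonic k : R) <= 1.
  by have /andP[/ltW -> ->] := s01 k.
have rv k : rint (dom h) (v k) := rint_segment (cvx_dom hc) hz rw (s01 k).
have wE := finite_EFin (hc.1 w) hw; have zE := finite_EFin (hc.1 z) hz.
pose M := (fine (phi w) - fine (phi z)) / L.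
pose P k := dotp (grad h (v k)) (w - z).
(* Tangent of h at v_k evaluated at z, against minimality of z at v_k. *)
have slope k : - M <= P k.
  have /andP[s0 _] := s01 k; set s := harmonic k in s0.
  have hzv : fine (h (v k)) - s * P k <= fine (h z).
    have := cvx_tangent hc (hdiff _ (rv k)) (x := z) (r := fine (h z)).
    have -> : z - v k = - (s *: (w - z)).
      by rewrite /v combineE opprD addrA subrr add0r.
    by rewrite dotpNr dotpZr -zE => /(_ (lexx _)).
  have [phiv phile] := cvx_fine phic phiz phiw (s01' k).
  have Cv := Cc z w _ (s01' k) zmin.1 Cw.
  have := argmin_le L0 phic.1 hc.1 zmin Cv phiv (rv k).1.
  rewrite -/(v k) -/s in phile *.
  rewrite -/(P k) /M lerNl ler_pdivlMr//.
  move=> H; rewrite -(ler_pM2l s0); nra.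
(* The value h (v_k) is bounded below by the tangent of h at w. *)
have bound e : exists B, forall k, dotp (grad h (v k)) e <= B.
  have [r r0 hq] := nbhs_direction e (differentiable_ext_nbhs_dom (hdiff w rw)).
  set q := w + r *: e in hq; have qE := finite_EFin (hc.1 q) hq.
  pose Pw := dotp (grad h w) (w - z).
  exists ((fine (h q) - fine (h w) + `|Pw| + `|M|) / r) => k.
  have /andP[s0 s1] := s01 k.
  rewrite ler_pdivlMr//.
  have hqv := cvx_tangent hc (hdiff _ (rv k)) (x := q) (r := fine (h q)).
  move: hqv; rewrite -qE => /(_ (lexx _)).
  have -> : q - v k = (1 - harmonic k) *: (w - z) + r *: e.
    rewrite /q /v; apply/rowP => i; rewrite !mxE; ring.
  rewrite dotpDr !dotpZr -/(P k) => hqv.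
  have := cvx_tangent hc (hdiff w rw) (x := v k) (r := fine (h (v k))).
  rewrite -(finite_EFin (hc.1 _) (rv k).1) => /(_ (lexx _)).
  have -> : v k - w = - ((1 - harmonic k) *: (w - z)).
    rewrite /v; apply/rowP => i; rewrite !mxE; ring.
  rewrite dotpNr dotpZr -/Pw.
  have := slope k; have := ler_norm Pw; have := ler_norm M.
  have := normr_ge0 Pw; have := normr_ge0 M.
  set s := harmonic k in s0 s1 hqv *; nra.
have /choice[B gradB] : forall i : 'I_n, exists B : R,
    forall k, `|grad h (v k) ord0 i| <= B.
  move=> i; have [B1 H1] := bound (delta_mx ord0 i).
  have [B2 H2] := bound (- delta_mx ord0 i).
  exists (Num.max B1 B2) => k.
  have := H1 k; have := H2 k; rewrite dotpNr dotp_delta => b2 b1.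
  by rewrite ler_norml le_max b1 andbT lerNl le_max b2 orbT.
have vz : v k @[k --> \oo] --> z.
  rewrite -[X in _ --> X](combine0 z w).
  apply: cvgD; apply: cvgZr_tmp; last exact: cvg_harmonic.
  by apply: cvgB; [exact: cvg_cst|exact: cvg_harmonic].
have zbd : (closure (dom h) `\` interior (dom h)) z.
  by split; [exact: subset_closure|move=> /nbhs_rint].
have := hblow v z rv zbd vz.
move=> /cvgry_ge /(_ (Num.sqrt (\sum_i B i ^+ 2) + 1)).
move=> /filter_ex[k].
apply/negP; rewrite -ltNge ltr_pwDr// ler_wsqrtr//.
apply: ler_sum => i _; rewrite -expr2 -real_normK ?num_real//.
by rewrite lerXn2r// ?nnegrE// (le_trans _ (gradB i k)).
Qed.

(** * Relative smoothness up to the boundary *)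

Lemma bregman_fin (R : realType) (n : nat) (h : 'rV[R]_n -> \bar R)
    (x y : 'rV[R]_n) :
  (forall v, -oo < h v)%E -> dom h x -> differentiable_ext h y ->
  bregman h x y =
    (fine (h x) - fine (h y) - dotp (grad h y) (x - y))%:E.
Proof.
move=> hNy hx dh; rewrite /bregman (finite_EFin (hNy x) hx).
by rewrite (differentiable_ext_fin dh).
Qed.

Lemma relatively_smooth_fine (R : realType) (n : nat) (C : set 'rV[R]_n)
    (h f : 'rV[R]_n -> \bar R) (L : R) (x y : 'rV[R]_n) :
  (forall v, -oo < h v)%E -> (forall v, -oo < f v)%E ->
  relatively_smooth C h f L -> C x -> dom h x -> rint C y ->
  differentiable_ext h y -> differentiable_ext f y ->
  dom f x /\
  fine (f x) <= fine (f y) + dotp (grad f y) (x - y)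
    + L * (fine (h x) - fine (h y) - dotp (grad h y) (x - y)).
Proof.
move=> hNy fNy [_ frs] Cx hx Cy dh df.
have := frs x y Cx Cy; rewrite bregman_fin//.
rewrite (differentiable_ext_fin df) -EFinM -!EFinD => fx.
have [fxE ?] := le_EFin_fin (fNy x) fx.
by split=> //; rewrite /dom/= fxE ltry.
Qed.

Lemma le_of_le_affine (R : realType) (a c d : R) :
  (forall s, 0 < s <= 1 -> a <= c + s * d) -> a <= c.
Proof.
move=> H; rewrite leNgt; apply/negP => ca.
have nd := ler_norm d; have nd0 := normr_ge0 d.
pose e := a - c; have e0 : 0 < e by rewrite subr_gt0.
have p0 : 0 < 2 * (`|d| + e) by lra.
have := H (e / (2 * (`|d| + e))).
rewrite divr_gt0// ler_pdivrMr// mul1r.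
have -> : e <= 2 * (`|d| + e) by lra.
move=> /(_ isT); set s := e / _ => Hs.
have s0 : 0 < s by rewrite divr_gt0.
have sE : s * (2 * (`|d| + e)) = e by rewrite divfK// gt_eqF.
by rewrite /e in sE *; nra.
Qed.

(** The points y_k of the method may lie on the relative boundary of C (already
    y_1 = z_1 can), while relative smoothness concerns y in rint C.  On rint C
    it says that g = L h - f lies above its tangents, hence g is convex on
    segments of C whose relevant points lie in rint C.  For xs between x and w,
    the half-open segment from y to xs lies in rint C, so convexity and
    differentiability of g at y give the tangent inequality at y; letting xs
    tend to x uses convexity of g on the segment from x to w. *)
Lemma relatively_smooth_closed (R : realType) (n : nat) (C : set 'rV[R]_n)
    (h f : 'rV[R]_n -> \bar R) (L : R) (x y w : 'rV[R]_n) :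
  convex_set C -> cvx h -> cvx f -> relatively_smooth C h f L ->
  (forall v, rint C v -> differentiable_ext h v /\ differentiable_ext f v) ->
  rint C w -> C x -> dom h x -> C y ->
  differentiable_ext h y -> differentiable_ext f y ->
  dom f x /\
  fine (f x) <= fine (f y) + dotp (grad f y) (x - y)
    + L * (fine (h x) - fine (h y) - dotp (grad h y) (x - y)).
Proof.
move=> Cc hc fc frs dhf rw Cx hx Cy dhy dfy.
have CcP := convex_setP Cc.
pose g v := L * fine (h v) - fine (f v).
have smooth p v : C p -> dom h p -> rint C v -> dom f p /\
    g v + (L * dotp (grad h v) (p - v) - dotp (grad f v) (p - v)) <= g p.
  move=> Cp hp rv; have [dhv dfv] := dhf v rv.
  have [fp H] := relatively_smooth_fine hc.1 fc.1 frs Cp hp rv dhv dfv.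
  by split => //; rewrite /g; lra.
have hdom v : differentiable_ext h v -> dom h v.
  by move=> dh; rewrite /dom/= (differentiable_ext_fin dh) ltry.
(* Combine the tangents at the intermediate point evaluated at p and q. *)
have gconv p q t : C p -> C q -> dom h p -> dom h q -> 0 <= t <= 1 ->
    rint C ((1 - t) *: p + t *: q) ->
    g ((1 - t) *: p + t *: q) <= (1 - t) * g p + t * g q.
  move=> Cp Cq hp hq /andP[t0 t1] rv; set v := _ + _ in rv *.
  have [_] := smooth p v Cp hp rv; have [_] := smooth q v Cq hq rv.
  have -> : q - v = (1 - t) *: (q - p).
    by apply/rowP => i; rewrite /v !mxE; ring.
  have -> : p - v = - t *: (q - p).
    by apply/rowP => i; rewrite /v !mxE; ring.
  by rewrite !dotpZr; nra.
have hw := hdom w (dhf w rw).1; have hy := hdom y dhy.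
have [fx _] := smooth x w Cx hx rw; split => //.
suff : L * dotp (grad h y) (x - y) - dotp (grad f y) (x - y) <= g x - g y.
  by rewrite /g; lra.
apply: (@le_of_le_affine _ _ _ ((g w - g x)
  - (L * dotp (grad h y) (w - x) - dotp (grad f y) (w - x)))) => s s01.
have s01' : 0 <= s <= 1 by case/andP: s01 => /ltW -> ->.
set xs := (1 - s) *: x + s *: w.
have rxs : rint C xs by exact: rint_segment.
have hxs := hdom xs (dhf xs rxs).1.
have gxs : g xs <= (1 - s) * g x + s * g w :=
  gconv x w s Cx rw.1 hx hw s01' rxs.
have : L * dotp (grad h y) (xs - y) + -1 * dotp (grad f y) (xs - y)
    <= g xs - g y.
  apply: directional_le => // t /andP[t0 t1]; rewrite -combineE.
  have t01 : 0 <= t <= 1 by rewrite !ltW.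
  have rv : rint C ((1 - t) *: y + t *: xs).
    by apply: rint_segment => //; rewrite t0 ltW.
  have := gconv y xs t Cy rxs.1 hy hxs t01 rv; set v := _ + _.
  have -> : L * (fine (h v) - fine (h y)) + -1 * (fine (f v) - fine (f y))
      = g v - g y by rewrite /g; ring.
  by lra.
have -> : xs - y = (x - y) + s *: (w - x).
  by apply/rowP => i; rewrite /xs !mxE; ring.
by rewrite !(dotpDr _ (x - y)) !dotpZr; lra.
Qed.

(** * The sequence theta *)

(** Bernoulli's inequality, from concavity of ln between 1 - v and 1. *)
Lemma powR_bernoulli (R : realType) (a v : R) : 1 <= a -> 0 <= v < 1 ->
  1 - v <= (1 - v / a) `^ a.
Proof.
move=> a1 /andP[v0 v1]; have a0 : 0 < a by exact: lt_le_trans a1.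
have va : v / a < 1 by rewrite ltr_pdivrMr// mul1r (lt_le_trans v1).
have ia0 : 0 <= a^-1 by rewrite invr_ge0 ltW.
have ia1 : a^-1 <= 1 by rewrite invf_le1.
have := @concave_ln R (Itv01 ia0 ia1) (1 - v) 1.
rewrite subr_gt0 v1 ltr01 => /(_ isT isT).
rewrite !convRE/= ln1 mulr0 addr0 => H.
rewrite -ler_ln ?posrE ?subr_gt0 ?powR_gt0 ?subr_gt0// ln_powR.
rewrite -ler_pdivrMl//; apply: (le_trans H).
rewrite (_ : a^-1 * (1 - v) + _ = 1 - v / a)//.
by rewrite /unstable.onem; ring.
Qed.

Lemma powR_inv (R : realType) (a x : R) : 0 < a -> a^-1 `^ x = (a `^ x)^-1.
Proof. by move=> a0; rewrite -powR_inv1 ?ltW// -powRrM mulN1r powRN. Qed.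

(** The recurrence reads (1 - q) q^(-gamma) = p^(-gamma), and Bernoulli's
    inequality bounds its left side by (1/q - 1/gamma)^gamma.  Thus 1 / theta
    grows by at least 1 / gamma per iteration. *)
Lemma theta_inv_step (R : realType) (gamma p q : R) :
  1 < gamma -> 0 < p <= 1 -> 0 < q <= 1 ->
  (1 - q) / q `^ gamma = 1 / p `^ gamma -> p^-1 + gamma^-1 <= q^-1.
Proof.
move=> g1 /andP[p0 p1] /andP[q0 q1]; have g0 : 0 < gamma by lra.
have gn0 : gamma != 0 by rewrite gt_eqF.
rewrite div1r => E.
have le1 : 1 - q <= (1 - q / gamma) `^ gamma.
  have [->|q_neq1] := eqVneq q 1; first by rewrite subrr powR_ge0.
  by apply: powR_bernoulli; rewrite ltW//= lt_neqAle q_neq1.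
have qg0 : 0 <= 1 - q / gamma.
  by rewrite subr_ge0 ler_pdivrMr// mul1r; lra.
have : p^-1 `^ gamma <= (q^-1 * (1 - q / gamma)) `^ gamma.
  rewrite powRM ?invr_ge0 ?(ltW q0)// !powR_inv// -E mulrC.
  by rewrite ler_pM2l ?invr_gt0 ?powR_gt0.
rewrite leNgt => H; rewrite leNgt; apply/negP => lt.
move: H => /negP; apply.
have -> : q^-1 * (1 - q / gamma) = q^-1 - gamma^-1.
  by rewrite mulrBr mulr1 mulrA mulVf ?mul1r// gt_eqF.
apply: gt0_ltr_powR => //; last by lra.
  by rewrite nnegrE subr_ge0 lef_pV2 ?posrE//; lra.
by rewrite nnegrE invr_ge0 ltW.
Qed.

(** * One iteration of the method *)

(** Since x' - y = theta (z' - z), the triangle scaling property turns the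
    Bregman term of relative smoothness into theta ^ gamma D_h(z', z), and the
    linearization at y splits along x' = (1 - theta) x + theta z'.  The bound
    on Psi x' is taken with a free real p because the initial x may lie outside
    dom Psi, in an iteration where theta = 1 multiplies p by 0. *)
Lemma abda_descent (R : realType) (n : nat) (C : set 'rV[R]_n)
    (h f Psi : 'rV[R]_n -> \bar R) (L gamma theta p : R)
    (x z z' w : 'rV[R]_n)
    (y := (1 - theta) *: x + theta *: z)
    (x' := (1 - theta) *: x + theta *: z') :
  convex_set C -> cvx h -> cvx f -> (forall v, -oo < Psi v)%E ->
  essentially_smooth h ->
  (forall v, rint C v -> differentiable_ext h v /\ differentiable_ext f v) ->
  rint C w -> relatively_smooth C h f L -> uniform_TSE h gamma ->
  0 < theta <= 1 -> differentiable_ext f y ->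
  C x -> C z -> C z' ->
  rint (dom h) x -> rint (dom h) z -> rint (dom h) z' ->
  (Psi x' <= ((1 - theta) * p + theta * fine (Psi z'))%:E)%E ->
  fine (f x') + fine (Psi x') <=
    (1 - theta) * (fine (f x) + p)
    + theta * (fine (f y) + dotp (grad f y) (z' - y) + fine (Psi z'))
    + L * (theta `^ gamma * fine (bregman h z' z)).
Proof.
move=> Cc hc fc PsiNy hsm dhf rw frs [_ tse] /andP[t0 t1] dfy Cx Cz Cz'
  rx rz rz' Psix'.
have t01 : 0 <= theta <= 1 by rewrite ltW.
have CcP := convex_setP Cc; have hd := cvx_dom hc.
have ry : rint (dom h) y by exact: rint_combine.
have rx' : rint (dom h) x' by exact: rint_combine.
have dhy := hsm.1 y ry; have dhz := hsm.1 z rz.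
have [_ smooth] := relatively_smooth_closed Cc hc fc frs dhf rw
  (CcP x z' theta t01 Cx Cz') rx'.1 (CcP x z theta t01 Cx Cz) dhy dfy.
have := tse x z' z theta rx rz' rz t01.
rewrite -/x' -/y !bregman_fin//;
  [|exact: hc.1|exact: rz'.1|exact: hc.1|exact: rx'.1].
rewrite -EFinM lee_fin /= -/x' => scale.
have [fx _] := relatively_smooth_closed Cc hc fc frs dhf rw Cx rx.1
  (CcP x z theta t01 Cx Cz) dhy dfy.
have := cvx_tangent fc dfy (x := x) (r := fine (f x)).
rewrite -(finite_EFin (fc.1 x) fx) => /(_ (lexx _)) tangent.
have [_ Psile] := le_EFin_fin (PsiNy _) Psix'.
have E : x' - y = (1 - theta) *: (x - y) + theta *: (z' - y).
  by apply/rowP => i; rewrite /x' !mxE; ring.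
have L0 := frs.1.
have dotE : dotp (grad f y) (x' - y) = (1 - theta) * dotp (grad f y) (x - y)
    + theta * dotp (grad f y) (z' - y).
  by rewrite E (dotpDr _ (_ *: _)) !dotpZr.
rewrite -(ler_pM2l L0) in scale.
have : 0 <= 1 - theta by rewrite subr_ge0.
move: smooth scale; rewrite -/x' -/y dotE.
set A := dotp _ (x - y) in tangent *.
move=> smooth scale t1'.
have := ler_wpM2l t1' tangent; lra.
Qed.

Lemma theta_rate (R : realType) (gamma : R) (theta : nat -> R) :
  1 < gamma -> theta 0%N = 1 ->
  (forall k : nat, 0 < theta k.+1 <= 1 /\
    (1 - theta k.+1) / theta k.+1 `^ gamma = 1 / theta k `^ gamma) ->
  forall k : nat, 0 < theta k <= 1 /\
    theta k `^ gamma <= (gamma / (k%:R + gamma)) `^ gamma.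
Proof.
move=> g1 t0 rec k; have g0 : 0 < gamma by lra.
have tb j : 0 < theta j <= 1.
  by case: j => [|j]; [rewrite t0 ltr01 lexx|exact: (rec j).1].
split=> //; have /andP[tk0 tk1] := tb k.
have kg : 0 < k%:R + gamma by rewrite ltr_wpDl// ler0n.
have : 1 + k%:R / gamma <= (theta k)^-1.
  elim: {tk0 tk1 kg}k => [|k IH]; first by rewrite t0 invr1 mul0r addr0.
  have := theta_inv_step g1 (tb k) (tb k.+1) (rec k).2.
  apply: le_trans; rewrite -natr1 mulrDl mul1r addrA lerD2r.
  exact: IH.
move=> H; apply: ge0_ler_powR; rewrite ?nnegrE.
- exact: ltW.
- exact: ltW.
- by rewrite divr_ge0// ltW.
rewrite -[leLHS]invrK -invf_div lef_pV2 ?posrE ?invr_gt0 ?divr_gt0//.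
by move: H; rewrite -{1}(divff (lt0r_neq0 g0)) -mulrDl addrC.
Qed.

Lemma theta_weight (R : realType) (gamma t : R) : 0 < t ->
  t `^ (1 - gamma) = t * (t `^ gamma)^-1.
Proof.
move=> t0; rewrite powRD ?powRN ?powRr1// ?ltW//.
by rewrite (gt_eqF t0) implybT.
Qed.

(** * The dual averages psi *)

Lemma cvx_linearization (R : realType) (n : nat)
    (f Psi : 'rV[R]_n -> \bar R) (y : 'rV[R]_n) :
  cvx Psi -> differentiable_ext f y -> cvx (fun v => linearization f Psi v y).
Proof.
move=> Psic dfy; rewrite /linearization (differentiable_ext_fin dfy).
by apply: cvxD => //; exact: cvx_affine.
Qed.

Lemma linearization_fin (R : realType) (n : nat)
    (f Psi : 'rV[R]_n -> \bar R) (y v : 'rV[R]_n) :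
  (forall v, -oo < Psi v)%E -> differentiable_ext f y -> dom Psi v ->
  linearization f Psi v y =
    (fine (f y) + dotp (grad f y) (v - y) + fine (Psi v))%:E.
Proof.
move=> PsiNy dfy Psiv; rewrite /linearization (differentiable_ext_fin dfy).
by rewrite (finite_EFin (PsiNy v) Psiv).
Qed.

(** Reduces psi to real arithmetic: away from dom Psi every psi k.+1 is +oo, so
    minimizers of psi k.+1 + L h never leave dom Psi. *)
Lemma dual_average_model (R : realType) (n : nat) (f Psi : 'rV[R]_n -> \bar R)
    (c : nat -> R) (y : nat -> 'rV[R]_n) (psi : nat -> 'rV[R]_n -> \bar R) :
  cvx Psi -> (forall k, 0 < c k) -> (forall k, differentiable_ext f (y k)) ->
  psi 0%N = (fun=> 0%E) ->
  (forall k v, psi k.+1 v =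
    (psi k v + (c k)%:E * linearization f Psi v (y k))%E) ->
  forall k, cvx (psi k) /\ forall v,
    [/\ dom Psi v -> dom (psi k) v, dom (psi k.+1) v -> dom Psi v &
      dom Psi v -> fine (psi k.+1 v) = fine (psi k v) +
        c k * (fine (f (y k)) + dotp (grad f (y k)) (v - y k) + fine (Psi v))].
Proof.
move=> Psic c0 dfy psi0 psiS.
have psic k : cvx (psi k).
  elim: k => [|k IH]; first by rewrite psi0; exact: cvx_cst0.
  rewrite (funext (psiS k)).
  exact: (cvxD IH (cvxZ (c0 k) (cvx_linearization Psic (dfy k)))).
have psidom k v : dom Psi v -> dom (psi k) v.
  move=> Psiv; elim: k => [|k IH]; first by rewrite psi0 /dom/= ltry.
  rewrite /dom/= psiS linearization_fin//; last exact: Psic.1.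
  by rewrite (finite_EFin ((psic k).1 v) IH) -EFinM -EFinD ltry.
move=> k; split => // v; split; first exact: psidom.
- rewrite /dom/= psiS /linearization (differentiable_ext_fin (dfy k)).
  move: ((psic k).1 v) (Psic.1 v) => + + psik.
  move: psik; case: (Psi v) => [r|//|//]; first by rewrite ltry.
  by rewrite addey// gt0_muley ?lte_fin//; case: (psi k v) => [r||].
- move=> Psiv; rewrite psiS linearization_fin//; last exact: Psic.1.
  by rewrite (finite_EFin ((psic k).1 v) (psidom k v Psiv)).
Qed.

(** The Bregman proximal step from z0 supplies a point of C and of dom Psi in
    the relative interior of dom h; argmin_rint needs one.  Comparison with u
    shows that the proximal objective is finite at that point. *)
Lemma BPG_witness (R : realType) (n : nat) (C : set 'rV[R]_n)
    (h f Psi : 'rV[R]_n -> \bar R) (z0 u : 'rV[R]_n) :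
  standing_assumption C h f Psi -> rint C z0 ->
  differentiable_ext h z0 -> differentiable_ext f z0 ->
  C u -> dom h u -> dom Psi u ->
  exists w, [/\ C w, rint (dom h) w & dom Psi w].
Proof.
move=> sa rz0 dh df Cu hu Psiu.
have hNy := sa_h_gtNy sa; have PsiNy := (sa_Psi_proper sa).1.
have [w [[Cw wmin] _] rw] := sa_BPG_well_posed sa rz0 ltr01.
exists w; split => //; have := wmin u Cu.
rewrite /BPG_objective !bregman_fin//; last exact: rw.1.
rewrite (differentiable_ext_fin df) (finite_EFin (PsiNy u) Psiu).
rewrite -!EFinM -!EFinD.
by rewrite /dom/=; case: (Psi w) => [r||]// _; rewrite ltry.
Qed.

(** * The convergence estimate *)

(** The common core of both estimates, between real numbers.  Here a j is
    theta_j^(-gamma), l j is the linearization at y_j, and m j is the minimum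
    of psi_j + L h, attained at z_j for j >= 1. *)
Lemma abda_bound (R : realType) (n : nat) (C : set 'rV[R]_n)
    (h f Psi : 'rV[R]_n -> \bar R) (L gamma : R)
    (x y z : nat -> 'rV[R]_n) (psi : nat -> 'rV[R]_n -> \bar R)
    (theta : nat -> R) (u : 'rV[R]_n) (k : nat) :
  standing_assumption C h f Psi -> relatively_smooth C h f L ->
  uniform_TSE h gamma -> ABDA C h f Psi L gamma x y z psi theta ->
  C u -> dom h u -> dom Psi u ->
  [/\ dom f (x k.+1), dom Psi (x k.+1), rint (dom h) (z 1%N) &
    fine (f (x k.+1)) + fine (Psi (x k.+1)) - (fine (f u) + fine (Psi u)) <=
      (gamma / (k%:R + gamma)) `^ gamma * L *
      (fine (h u) - fine (h (z 1%N)) + fine (bregman h (z 1%N) (z 0%N)))].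
Proof.
move=> sa frs tse run Cu hu Psiu.
have Cc := sa_C_convex sa; have CcP := convex_setP Cc.
have hc : cvx h := strictly_convex_cvx (sa_h_gtNy sa) (sa_h_strictly_convex sa).
have fc : cvx f := convex_ext_cvx (sa_f_proper sa).1 (sa_f_convex sa).
have Psic : cvx Psi := convex_ext_cvx (sa_Psi_proper sa).1 (sa_Psi_convex sa).
have hsm := (sa_h_Legendre sa).1.
have dhf v : rint C v -> differentiable_ext h v /\ differentiable_ext f v.
  have [U [_ CU dU]] := sa_h_differentiable sa.
  have [V [_ CV dV]] := sa_f_differentiable sa.
  by move=> rv; split; [exact/dU/CU|exact/dV/CV].
have rz0 := abda_z0 run; have [dhz0 dfz0] := dhf _ rz0.
have L0 := frs.1; have g1 := abda_gamma run.
have dfy := abda_grad run.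
have thetaP := theta_rate g1 (abda_theta0 run) (abda_theta run).
have tpos j : 0 < theta j by case: (thetaP j) => /andP[].
have t01 j : 0 <= theta j <= 1 by case: (thetaP j) => /andP[/ltW -> ->].
have model := dual_average_model Psic
  (fun j => powR_gt0 (1 - gamma) (tpos j)) dfy (abda_psi0 run) (abda_psi run).
have psic j : cvx (psi j) := (model j).1.
have psidom j v : dom Psi v -> dom (psi j) v by case: ((model j).2 v).
have domPsi j v : dom (psi j.+1) v -> dom Psi v by case: ((model j).2 v).
have psiS j v : dom Psi v -> fine (psi j.+1 v) = fine (psi j v) +
    theta j * (theta j `^ gamma)^-1 *
      (fine (f (y j)) + dotp (grad f (y j)) (v - y j) + fine (Psi v)).
  by move=> Psiv; rewrite -theta_weight//; case: ((model j).2 v) => _ _; apply.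
have [w [Cw rw Psiw]] := BPG_witness sa rz0 dhz0 dfz0 Cu hu Psiu.
(* The iterates stay where h is differentiable. *)
have zP j : [/\ C (z j.+1), rint (dom h) (z j.+1) & dom Psi (z j.+1)].
  have zmin := abda_z run j; split; first exact: zmin.1.
    exact: (argmin_rint Cc L0 (psic j.+1) hc hsm zmin Cw (psidom _ _ Psiw) rw).
  have [+ _] :=
    argmin_finite L0 (psic j.+1).1 hc.1 zmin Cu (psidom _ _ Psiu) hu.
  exact: domPsi.
have zC j : C (z j) by case: j => [|j]; [exact: rz0.1|case: (zP j)].
have zr j : rint (dom h) (z j).
  case: j => [|j]; last by case: (zP j).
  exact/nbhs_rint/differentiable_ext_nbhs_dom.
have xP j : C (x j) /\ rint (dom h) (x j).
  elim: j => [|j [Cx rx]]; first by rewrite (abda_x0 run).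
  rewrite (abda_x run); split; first exact: CcP.
  by apply: rint_combine => //; exact: cvx_dom.
have x1 : x 1%N = z 1%N by rewrite (abda_x run) (abda_theta0 run) combine1.
have xPsi j : dom Psi (x j.+1).
  elim: j => [|j IH]; first by rewrite x1; case: (zP 0%N).
  rewrite (abda_x run); have [_ _ Psiz] := zP j.+1.
  by case: (cvx_fine Psic IH Psiz (t01 j.+1)).
have domf v : C v -> dom h v -> dom f v.
  move=> Cv hv.
  by case: (relatively_smooth_fine hc.1 fc.1 frs Cv hv rz0 dhz0 dfz0).
pose F v := fine (f v) + fine (Psi v).
pose a j := (theta j `^ gamma)^-1.
pose l j v := fine (f (y j)) + dotp (grad f (y j)) (v - y j) + fine (Psi v).
pose D j := fine (bregman h (z j.+1) (z j)).
pose m j := fine (psi j (z j)) + L * fine (h (z j)).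
have a0 j : 0 < a j by rewrite invr_gt0 powR_gt0.
have a_init : a 0%N = 1 by rewrite /a (abda_theta0 run) powR1 invr1.
have aS j : a j.+1 * (1 - theta j.+1) = a j.
  by have := (abda_theta run j).2; rewrite div1r mulrC.
have l_le j v : dom f v -> l j v <= F v.
  move=> fv; rewrite /l /F lerD2r.
  by apply: cvx_tangent => //; rewrite -(finite_EFin (fc.1 v) fv).
have step j : F (x j.+1) <= (1 - theta j) * F (x j) + theta j * l j (z j.+1)
    + L * (theta j `^ gamma * D j).
  rewrite /F /l /D (abda_x run) (abda_y run).
  apply: (abda_descent Cc hc fc Psic.1 hsm dhf rz0 frs tse) => //.
  - by case: (thetaP j).
  - by rewrite -(abda_y run).
  - by case: (xP j).
  - by case: (xP j).
  - rewrite -(abda_x run).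
    case: j => [|j].
      rewrite x1 (abda_theta0 run) subrr mul0r mul1r add0r.
      by rewrite -(finite_EFin (Psic.1 _)) //; case: (zP 0%N).
    have [_ _ Psiz] := zP j.+1.
    have [_] := cvx_fine Psic (xPsi j) Psiz (t01 j.+1).
    rewrite -(abda_x run) => H.
    by rewrite (finite_EFin (Psic.1 _) (xPsi j.+1)) lee_fin.
have D_E j : D j = fine (h (z j.+1)) - fine (h (z j))
    - dotp (grad h (z j)) (z j.+1 - z j).
  by rewrite /D bregman_fin//; [exact: hc.1|case: (zr j.+1)|exact: hsm.1].
(* The three-point inequality at z_{j+1}, evaluated at z_{j+2}. *)
have m_step j : m j.+1 + L * D j.+1 + theta j.+1 * a j.+1 * l j.+1 (z j.+2)
    <= m j.+2.
  have [_ _ Psiz] := zP j.+1.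
  have := argmin_first_order Cc L0 (psic j.+1) hc (abda_z run j)
    (hsm.1 _ (zr j.+1)) (zC j.+2) (psidom _ _ Psiz) (zr j.+2).1.
  by rewrite /m D_E (psiS j.+1 _ Psiz) -/(l _ _) -/(a _); lra.
(* Descent divided by theta^gamma telescopes with m_step. *)
have tele j : a j * F (x j.+1) - m j.+1 <= F (x 1%N) - m 1%N.
  elim: j => [|j IH]; first by rewrite a_init mul1r.
  have := m_step j; have := step j.+1; rewrite -(ler_pM2l (a0 j.+1)).
  have aK : a j.+1 * theta j.+1 `^ gamma = 1.
    by rewrite mulVf// gt_eqF ?powR_gt0.
  rewrite [X in _ <= X -> _](_ : _ = a j.+1 * (1 - theta j.+1) * F (x j.+1)
    + theta j.+1 * a j.+1 * l j.+1 (z j.+2)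
    + L * (a j.+1 * theta j.+1 `^ gamma) * D j.+1); last by ring.
  by rewrite aS aK; lra.
(* The weights theta_i a_i for 1 <= i <= j sum to a_j - 1. *)
have psi_le j v : C v -> dom h v -> dom Psi v ->
    fine (psi j.+1 v) <= fine (psi 1%N v) + (a j - 1) * F v.
  move=> Cv hv Psiv; elim: j => [|j IH].
    by rewrite a_init subrr mul0r addr0.
  rewrite psiS// -/(l _ _) -/(a _).
  have wpos : 0 <= theta j.+1 * a j.+1 by rewrite mulr_ge0 ?ltW.
  have := ler_wpM2l wpos (l_le j.+1 v (domf v Cv hv)).
  have := aS j; nra.
have m_le j v : C v -> dom h v -> dom Psi v ->
    m j.+1 <= fine (psi 1%N v) + (a j - 1) * F v + L * fine (h v).
  move=> Cv hv Psiv.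
  have := argmin_le L0 (psic j.+1).1 hc.1 (abda_z run j) Cv
    (psidom _ _ Psiv) hv.
  by have := psi_le j v Cv hv Psiv; rewrite /m; lra.
have psi1 v : dom Psi v -> fine (psi 1%N v) = l 0%N v.
  move=> Psiv; rewrite psiS// (abda_psi0 run) add0r (abda_theta0 run).
  by rewrite powR1 invr1 !mul1r.
have first_step : F (x 1%N) <= l 0%N (z 1%N) + L * D 0%N.
  by have := step 0%N; rewrite (abda_theta0 run) powR1; lra.
have [Cz1 rz1 Psiz1] := zP 0%N.
have m1E : m 1%N = l 0%N (z 1%N) + L * fine (h (z 1%N)) by rewrite /m psi1.
set E := fine (h u) - fine (h (z 1%N)) + D 0%N.
have Fu_bound j : a j * (F (x j.+1) - F u) <= L * E.
  have := tele j; have := m_le j u Cu hu Psiu; rewrite psi1//.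
  have := l_le 0%N u (domf u Cu hu).
  by rewrite /E; lra.
(* Test the minimum m_{j+1} at z_1, which is also x_1. *)
have monotone j : F (x j.+1) <= F (x 1%N).
  rewrite -(ler_pM2l (a0 j)); have := tele j.
  have := m_le j _ Cz1 rz1.1 Psiz1; rewrite psi1// m1E -x1; lra.
have [Cx rx] := xP k.+1.
split; [exact: domf rx.1|exact: xPsi|by []|].
rewrite -!/(F _) -/(D _) -/E -mulrA.
have [_ rate] := thetaP k; set c := (gamma / _) `^ gamma in rate *.
(* Replacing theta_k^gamma by the larger rate c preserves the bound if E >= 0.
   Otherwise F (x_{k+1}) <= F (x_1) <= F u + L E, and c <= 1. *)
have [E0|E0] := leP 0 E.
  apply: (@le_trans _ _ (theta k `^ gamma * (L * E))).
    by rewrite -ler_pdivrMl ?powR_gt0//; exact: Fu_bound.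
  by rewrite ler_wpM2r// mulr_ge0// ltW.
have c1 : c <= 1.
  have one : 1 `^ gamma = 1 :> R by rewrite powR1.
  rewrite /c -[leRHS]one; apply: ge0_ler_powR; rewrite ?nnegrE; try lra.
    by rewrite divr_ge0//; [lra|rewrite addr_ge0// ?ler0n//; lra].
  rewrite ler_pdivrMr ?mul1r ?lerDr ?ler0n//.
  by rewrite ltr_wpDl// ?ler0n//; lra.
have LE0 : L * E <= 0 by rewrite pmulr_rle0// ltW.
have := Fu_bound 0%N; rewrite a_init mul1r.
have := monotone k; nra.
Qed.

Theorem theorem4 (R : realType) (n : nat) (C : set 'rV[R]_n)
    (h f Psi : 'rV[R]_n -> \bar R) (L gamma : R)
    (x y z : nat -> 'rV[R]_n) (psi : nat -> 'rV[R]_n -> \bar R)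
    (theta : nat -> R) (F := fun u => (f u + Psi u)%E) :
  standing_assumption C h f Psi ->
  relatively_smooth C h f L ->
  uniform_TSE h gamma ->
  ABDA C h f Psi L gamma x y z psi theta ->
  (is_argmin C h (z 0%N) ->
   forall u, C u -> dom h u -> forall k : nat,
     (F (x k.+1) - F u <=
      ((gamma / (k%:R + gamma)) `^ gamma * L)%:E * (h u - h (z 0%N)))%E) /\
  (~ is_argmin C h (z 0%N) ->
   forall u, C u -> dom h u -> forall k : nat,
     (F (x k.+1) - F u <=
      ((gamma / (k%:R + gamma)) `^ gamma * L)%:E *
      (h u - h (z 1%N) + bregman h (z 1%N) (z 0%N)))%E).
Proof.
move=> sa frs tse run.
have hNy := sa_h_gtNy sa.
have fNy := (sa_f_proper sa).1; have PsiNy := (sa_Psi_proper sa).1.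
have [U [_ CU dU]] := sa_h_differentiable sa.
have dhz0 : differentiable_ext h (z 0%N) by exact/dU/CU/(abda_z0 run).
have bound u k : C u -> dom h u -> (F u < +oo)%E -> exists r : R,
  [/\ (F (x k.+1) - F u)%E = r%:E, rint (dom h) (z 1%N) &
    r <= (gamma / (k%:R + gamma)) `^ gamma * L *
      (fine (h u) - fine (h (z 1%N)) + fine (bregman h (z 1%N) (z 0%N)))].
  move=> Cu hu; rewrite /F => Fu.
  have [fu Psiu] : dom f u /\ dom Psi u.
    move: Fu (fNy u) (PsiNy u); rewrite /dom/=.
    by case: (f u); case: (Psi u) => //= *; rewrite ?ltry.
  have [fx Psix rz1 H] := abda_bound k sa frs tse run Cu hu Psiu.
  rewrite (finite_EFin (fNy _) fx) (finite_EFin (PsiNy _) Psix).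
  rewrite (finite_EFin (fNy _) fu) (finite_EFin (PsiNy _) Psiu).
  by rewrite -!EFinD; eexists; split; [reflexivity| |exact: H].
have infinite u k r : ~ (F u < +oo)%E -> (F (x k.+1) - F u <= r)%E.
  move=> /negP; rewrite -leNgt leye_eq => /eqP ->.
  by rewrite addeNy ?leNye.
split=> [z0min|_] u Cu hu k.
  have [Fu|/negP/infinite//] := boolP (F u < +oo)%E.
  have [r [-> rz1 H]] := bound u k Cu hu Fu.
  rewrite (differentiable_ext_fin dhz0) (finite_EFin (hNy u) hu).
  rewrite -EFinN -EFinD -EFinM lee_fin; apply: (le_trans H).
  apply: ler_wpM2l; first by rewrite mulr_ge0 ?powR_ge0// ltW// frs.1.
  rewrite bregman_fin//=; last exact: rz1.1.
  (* Minimality of z_0 gives D_h(z_1, z_0) <= h z_1 - h z_0: the three-point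
     inequality for the zero function and L = 1. *)
  have z0min' : is_argmin C (fun v => 0 + 1%:E * h v)%E (z 0%N).
    split; first exact: z0min.1.
    by move=> v Cv; rewrite !add0e !mul1e; exact: z0min.2.
  have hc := strictly_convex_cvx hNy (sa_h_strictly_convex sa).
  have := argmin_first_order (sa_C_convex sa) ltr01 (@cvx_cst0 R n) hc
    z0min' dhz0 (abda_z run 0%N).1 (ltry 0) rz1.1.
  by rewrite /=; lra.
have [Fu|/negP/infinite//] := boolP (F u < +oo)%E.
have [r [-> rz1 H]] := bound u k Cu hu Fu.
have -> : bregman h (z 1%N) (z 0%N) = (fine (bregman h (z 1%N) (z 0%N)))%:E.
  by rewrite bregman_fin//; exact: rz1.1.
rewrite (finite_EFin (hNy u) hu) (finite_EFin (hNy _) rz1.1).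
by rewrite -EFinN -!EFinD -EFinM lee_fin.
Qed.
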